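(* Let $T\colon X\to X$ be a homeomorphism of a compact metric space and let $\mu$ be an ergodic $T$-invariant Borel probability measure on $X$. Let $G$ be a compact metrizable group, $\lambda_G$ the (normalized) Haar measure of $G$, and $\varphi\colon X\to G$ a continuous map. Define $Y=X\times G$ and $S\colon Y\to Y$ by $S(x,g)=(T(x),\varphi(x)g)$. If $S$ is ergodic with respect to $\mu\times\lambda_G$, then $(Y,S,\mu\times\lambda_G)$ uniquely extends $(X,T,\mu)$ over the projection $\pi\colon Y\ni(x,g)\mapsto x\in X$.
   Context: Let $(X,T)$ and $(Y,S)$ be dynamical systems (homeomorphisms of compact metric spaces), let $\pi\colon Y\to X$ be a factor map (continuous, onto, with $\pi\circ S=T\circ\pi$), and let $\mu$ be an ergodic $T$-invariant Borel probability measure on $X$. One says that $(Y,S,\nu)$ uniquely extends $(X,T,\mu)$ over $\pi$ if $\nu$ is an ergodic $S$-invariant Borel probability measure on $Y$ with $\pi_*(\nu)=\mu$ and it is the unique ergodic $S$-invariant Borel probability measure on $Y$ with this property. *)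

(* Defs.v *)
From HB Require Import structures.
From mathcomp Require Import all_boot all_order all_algebra finmap.
From mathcomp Require Import all_classical all_reals all_analysis.

Set Implicit Arguments.
Unset Strict Implicit.
Unset Printing Implicit Defensive.

Import Order.TTheory GRing.Theory Num.Theory.

Local Open Scope classical_set_scope.
Local Open Scope ring_scope.

(* The library's measurable types are pointed, hence so are the spaces below;
   this is no restriction for a space carrying a probability or a group law. *)
#[short(type="pmetricType")]
HB.structure Definition PointedMetric (R : numDomainType) :=
  {M of Pointed M & Metric R M}.

HB.mixin Record isTopologicalGroup G & Topological G & Group G := {
  mulg_continuous : continuous (fun x : G * G => (x.1 * x.2)%g) ;
  invg_continuous : continuous (fun x : G => (x^-1)%g)
}.

#[short(type="ptopologicalGroupType")]
HB.structure Definition PointedTopologicalGroup :=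
  {G of PointedTopological G & Group G & isTopologicalGroup G}.

HB.instance Definition _ (X Y : ptopologicalType) := Pointed.on (X * Y)%type.

Notation borel T := (g_sigma_algebraType (@open T%type)).

Definition metrizable (R : realType) (T : topologicalType) :=
  exists d : T -> T -> R,
    [/\ forall x y, d x y = 0 <-> x = y,
        forall x y, d x y = d y x,
        forall x y z, d x z <= d x y + d y z &
        forall x, nbhs x =
          filter_from [set e : R | 0 < e] (fun e : R => [set y | d x y < e])].

Lemma compact_metrizable_second_countable (R : realType)
    (T : ptopologicalType) : metrizable R T ->
  compact [set: T] -> @second_countable T.
Proof.
move=> [d [d0 dC dD nbhsd]] cT.
have nbhs_d (x : T) (e : R) : 0 < e -> nbhs x [set y | d x y < e].
  by move=> e0; rewrite nbhsd; exists e.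
have npos n : (0 : R) < n.+1%:R^-1 by [].
pose f n (z : T) : set T := [set y | d z y < n.+1%:R^-1]°.
have h n : finite_subset_cover [set: T] (f n) [set: T].
  move: cT; rewrite compact_cover; apply.
  - by move=> z _; rewrite /f; exact: open_interior.
  - by move=> z _; exists z => //; rewrite /f /interior; exact: nbhs_d.
pose h' n := cid (iffLR (exists2P _ _) (h n)).
pose h'' n := projT1 (h' n).
pose B := \bigcup_n (f n) @` [set` h'' n]; exists B; [|split].
- apply: bigcup_countable => // n _; apply: finite_set_countable.
  exact/finite_image/finite_fset.
- by move=> ? [? _ [? _ <-]]; exact: open_interior.
- move=> x V; rewrite nbhsd => -[e /= e0 eV].
  have [//|N] := @ltr_add_invr R 0%R (e / 2) _; first by rewrite divr_gt0.
  rewrite add0r => deleps.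
  have [w wh fx] : exists2 w : T, w \in h'' N & f N w x.
    by have [_ /(_ x) [// | w ? ?]] := projT2 (h' N); exists w.
  exists (f N w); first by split => //; exists N => //; exists w.
  move=> z /interior_subset /= wz; apply: eV => /=.
  move/interior_subset : fx => /= wx.
  rewrite (le_lt_trans (dD x w z))// (splitr e) ltrD//.
    by rewrite dC (lt_trans wx).
  exact: lt_trans wz deleps.
Qed.

Lemma borel_prod_measurable (X Y : ptopologicalType) :
  @second_countable X -> @second_countable Y ->
  measurable_fun [set: (borel X * borel Y)%type]
    (fun z : borel X * borel Y => z : borel (X * Y)).
Proof.
move=> [BX cX [BXo BXn]] [BY cY [BYo BYn]].
apply: (@measurability _ _ _ (borel (X * Y)) _ _ (@open (X * Y)%type)) => //.
move=> _ [U oU <-]; rewrite setTI.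
pose D := [set p : set X * set Y | [/\ BX p.1, BY p.2 & p.1 `*` p.2 `<=` U]].
have -> : (fun z : borel X * borel Y => z : borel (X * Y)) @^-1` U
    = \bigcup_(p in D) (p.1 `*` p.2).
  apply/seteqP; split=> [[x y] /= Uxy|z [p [_ _ pU] /pU//]].
  have /= := open_nbhs_nbhs (conj oU Uxy).
  move=> [[/= V W] [/BXn [V' [BV' V'x] V'V] /BYn [W' [BW' W'y] W'W]] VWU].
  exists (V', W') => //; split=> // -[a b] /= [/V'V Va /W'W Wb].
  exact: VWU.
have cD : countable D.
  apply: sub_countable (countableX cX cY); apply: subset_card_le.
  by move=> p [].
rewrite bigcup_set_type; apply: countable_bigcupT_measurable.
  by rewrite (eq_countable (card_setT D)).
move=> [p /= /set_mem[BXp BYp _]]; apply: measurableX.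
- by apply: sub_sigma_algebra; exact: BXo.
- by apply: sub_sigma_algebra; exact: BYo.
Qed.

Section borel_prod.
Context {R : realType} {X Y : ptopologicalType}.
Hypotheses (sX : @second_countable X) (sY : @second_countable Y).

Let to_borel (z : borel X * borel Y) : borel (X * Y) := z.

Let measurable_to_borel : measurable_fun [set: borel X * borel Y] to_borel.
Proof. exact: borel_prod_measurable. Qed.

HB.instance Definition _ :=
  isMeasurableFun.Build _ _ _ _ to_borel measurable_to_borel.

(* The product measure, defined by the library on the product of the two Borel
   sigma-algebras, as a measure on the Borel sigma-algebra of the product
   topology; second countability makes these two sigma-algebras coincide. *)
Definition borel_prod (mu : probability (borel X) R)
    (nu : probability (borel Y) R) : probability (borel (X * Y)) R :=
  distribution (mu \x nu)%E to_borel.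

End borel_prod.

Definition homeomorphism (X Y : topologicalType) (f : X -> Y) :=
  continuous f /\ exists2 g : Y -> X, continuous g & cancel f g /\ cancel g f.

Definition dynamical_system (R : realType) (X : topologicalType) (T : X -> X) :=
  [/\ compact [set: X], metrizable R X & homeomorphism T].

Definition factor_map (R : realType) (Y X : topologicalType)
    (S : Y -> Y) (T : X -> X) (pi : Y -> X) :=
  [/\ dynamical_system R S, dynamical_system R T, continuous pi,
      set_surj [set: Y] [set: X] pi & pi \o S = T \o pi].

Section ergodicity.
Context {d : measure_display} {X : measurableType d} {R : realType}.
Implicit Types (T : X -> X) (mu : probability X R).

Definition invariant T mu := forall A, measurable A -> mu (T @^-1` A) = mu A.

Definition ergodic T mu :=
  forall A, measurable A -> T @^-1` A = A -> mu A = 0%E \/ mu A = 1%E.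

Definition ergodic_invariant T mu := invariant T mu /\ ergodic T mu.

End ergodicity.

(* Only left invariance is required; right invariance follows when G is compact.
   The type [probability] carries the normalization. *)
Definition haar_measure (R : realType) (G : ptopologicalGroupType)
    (la : probability (borel G) R) :=
  forall g : G, invariant (fun h : borel G => (g * (h : G))%g) la.

Definition extends (R : realType) (Y X : ptopologicalType) (S : Y -> Y)
    (pi : Y -> X) (nu : probability (borel Y) R) (mu : probability (borel X) R) :=
  ergodic_invariant (S : borel Y -> borel Y) nu /\
  forall A : set (borel X), measurable A ->
    pushforward nu (pi : borel Y -> borel X) A = mu A.

(* The values of a library measure outside its sigma-algebra are arbitrary, so
   uniqueness means agreement on Borel sets. *)
Definition uniquely_extends (R : realType) (Y X : ptopologicalType)
    (S : Y -> Y) (T : X -> X) (pi : Y -> X)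
    (nu : probability (borel Y) R) (mu : probability (borel X) R) :=
  [/\ factor_map R S T pi, ergodic_invariant (T : borel X -> borel X) mu,
      extends S pi nu mu &
      forall nu' : probability (borel Y) R, extends S pi nu' mu ->
        forall A : set (borel Y), measurable A -> nu' A = nu A].

Definition skew_product (X : Type) (G : groupType) (T : X -> X) (phi : X -> G)
    (y : X * G) : X * G := (T y.1, (phi y.1 * y.2)%g).

(* Main.v *)
Require Import Defs.
From HB Require Import structures.
From mathcomp Require Import all_boot all_order all_algebra.
From mathcomp Require Import all_classical all_reals all_analysis.

Set Implicit Arguments.
Unset Strict Implicit.
Unset Printing Implicit Defensive.

Import Order.TTheory GRing.Theory Num.Theory.
Local Open Scope classical_set_scope.
Local Open Scope ring_scope.

(** The proof rests on the principle that an invariant measure dominated by an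
ergodic one is proportional to it.

Write [nu = mu x la], and let [nu'] be an [S]-invariant probability on [X * G]
that projects to [mu].  The right translations [(x, g) |-> (x, g h)] commute
with [S].  Draw [h] with law [la] and, independently, [(x, g)] with law [nu'],
and let [P] be the joint law of [(h, (x, g h))].
- The second marginal of [P] is [nu]: given [(x, g)], left invariance makes
  [g h] distributed as [la], and [x] has law [mu].
- For a Borel set [B] of [G] the measure [A |-> P (B x A)] is [S]-invariant,
  because [S] commutes with translations, and it is at most [nu] by the first
  point.  As [nu] is ergodic it equals [la B * nu A] (lemma
  [ergodic_dominated]).  Thus [h] and [(x, g h)] are independent: [P] is the
  product [la x nu].
- Translating back by [h^-1] turns [P] into [nu'].  Translating [la x nu] by
  [h^-1] gives [nu], since [nu] is invariant under right translations.  Hence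
  [nu' = nu].

Right invariance of [la], used in the last point, follows from left invariance
by a convolution argument ([haar_invg]).  The extremality lemma
[ergodic_dominated] is obtained from a Hahn decomposition of
[kappa - kappa(Y) nu], whose positive set can be replaced by a strictly
invariant one ([invariant_hahn_set]).

The argument takes place on the product sigma-algebra, where Fubini is
available; [X * G] being second countable, it is the Borel one, and the theorem
is transferred at the end.  That the system is a factor extension also requires
[X * G] to be compact metrizable and [S] to be a homeomorphism. *)

(** * Invariant charges and extremality of ergodic measures *)

Section invariant_charge.
Local Open Scope ereal_scope.
Local Open Scope charge_scope.
Context d (Y : measurableType d) (R : realType).
Implicit Type sigma : {charge set Y -> \bar R}.

(** [P `\` S @^-1` P] and [S @^-1` P `\` P] have the same charge, because
[sigma P] is finite and equal to [sigma (S @^-1` P)]; but the first set lies in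
[P] and the second in [N], so this charge is zero.  A subset of a positive set
of charge zero has charge zero. *)
Lemma negative_set_setD_preimage sigma (P N : set Y) (S : Y -> Y) :
  measurable_fun [set: Y] S ->
  (forall A, measurable A -> sigma (S @^-1` A) = sigma A) ->
  hahn_decomposition sigma P N -> sigma.-negative_set (P `\` S @^-1` P).
Proof.
move=> mS sS [[mP posP] [mN negN] PN PN0].
have mSP : measurable (S @^-1` P) by rewrite -[X in measurable X]setTI; exact: mS.
have mD : measurable (P `\` S @^-1` P) by exact: measurableD.
split=> // A mA AD.
have D0 : sigma (P `\` S @^-1` P) <= 0.
  rewrite chargeD// setIC -(sS P)// -chargeD//.
  apply: negN; first exact: measurableD.
  move=> x [_ nPx]; have : setT x by [].
  by rewrite -PN => -[].
have DA0 : 0 <= sigma ((P `\` S @^-1` P) `\` A).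
  apply: posP; first exact: measurableD.
  by move=> x [[]].
move: DA0; rewrite chargeD// (setIidr AD) sube_ge0 ?fin_num_measure//.
  by move=> /le_trans; exact.
Qed.

Lemma hahn_decompositionN sigma (P N : set Y) :
  hahn_decomposition sigma P N -> hahn_decomposition (copp sigma) N P.
Proof.
move=> [[mP posP] [mN negN] PN PN0]; split.
- by split=> // A mA /(negN _ mA); rewrite /copp oppe_ge0.
- by split=> // A mA /(posP _ mA); rewrite /copp oppe_le0.
- by rewrite setUC.
- by rewrite setIC.
Qed.

(** The set of points that visit [P] infinitely often is strictly invariant.  It
differs from [P] by countable unions of pieces of [P `\` S^-n P] and
[N `\` S^-n N], all of them of charge zero by [negative_set_setD_preimage] applied to the
iterates of [S], once for [sigma] and once for its opposite. *)
Lemma invariant_hahn_set sigma (P N : set Y) (S : Y -> Y) :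
  measurable_fun [set: Y] S ->
  (forall A, measurable A -> sigma (S @^-1` A) = sigma A) ->
  hahn_decomposition sigma P N ->
  exists V, [/\ measurable V, S @^-1` V = V & sigma V = sigma P].
Proof.
move=> mS sS PN.
have [[mP posP] [mN negN] PNT PN0] := PN.
have mSn n : measurable_fun [set: Y] (iter n S).
  elim: n => [|n ih]; first exact: measurable_id.
  exact: (measurableT_comp mS ih).
have mpre n A : measurable A -> measurable (iter n S @^-1` A).
  by move=> mA; rewrite -[X in measurable X]setTI; exact: mSn.
have sSn n A : measurable A -> sigma (iter n S @^-1` A) = sigma A.
  elim: n A => // n ih A mA.
  transitivity (sigma (S @^-1` A)); last exact: sS.
  exact: (ih (S @^-1` A) (mpre 1%N A mA)).
pose V := lim_sup_set (fun n => iter n S @^-1` P).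
have mV : measurable V.
  apply: bigcap_measurable => // n _.
  by apply: bigcup_measurable => k _; exact: mpre.
have NP : hahn_decomposition (copp sigma) N P by exact: hahn_decompositionN.
have negD : sigma.-negative_set (\bigcup_n (P `\` iter n S @^-1` P)).
  apply: bigcup_negative_set => n.
  by apply: negative_set_setD_preimage PN => //; exact: sSn.
have posD : (copp sigma).-negative_set (\bigcup_n (N `\` iter n S @^-1` N)).
  apply: bigcup_negative_set => n.
  apply: negative_set_setD_preimage NP => //.
  by move=> A mA; rewrite /= /copp sSn.
have PV : sigma (P `\` V) = 0.
  apply/eqP; rewrite eq_le; apply/andP; split.
    apply: negD.2; first exact: measurableD.
    move=> x [Px]; apply: contra_notP => h n _; exists n => //=.
    by apply: contrapT => nPn; apply: h; exists n.
  by apply: posP; [exact: measurableD|exact: subDsetl].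
have VP : sigma (V `\` P) = 0.
  have VPN : V `\` P `<=` N.
    by move=> x [_ nPx]; have : setT x by []; rewrite -PNT => -[].
  apply/eqP; rewrite eq_le; apply/andP; split.
    by apply: negN => //; exact: measurableD.
  rewrite -oppe_le0; apply: posD.2; first exact: measurableD.
  move=> x VPx; have [/(_ 0%N I)[k _ /= Pkx] _] := VPx.
  exists k => //; split; first exact: VPN.
  by move=> /= Nkx; have : (P `&` N) (iter k S x) by []; rewrite PN0.
exists V; split => //.
- apply/seteqP; split => x Vx n _.
    have [k /= nk Pk] := Vx n I; exists k.+1; first exact: leq_trans nk _.
    by rewrite /= -iterS iterSr.
  have [[|k] /= nk Pk] := Vx n.+1 I => //; exists k => //=.
  by rewrite -iterSr.
- by rewrite (chargeDI sigma mV mP) (chargeDI sigma mP mV) PV VP !add0e setIC.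
Qed.

End invariant_charge.

Section ergodic_extremality.
Local Open Scope ereal_scope.
Context d (Y : measurableType d) (R : realType).

(** Extremality of ergodic measures, in the form needed here.  Let [sigma] be the
charge [kappa - kappa(Y) nu], of total mass zero.  By ergodicity an invariant
set or its complement is [nu]-null, hence [kappa]-null by domination, hence
[sigma]-null, so every invariant set has charge zero.  In particular an
invariant version of the positive Hahn set has charge zero, and then both Hahn
sets carry nothing. *)
Lemma ergodic_dominated (S : Y -> Y) (nu : probability Y R)
    (kappa : {measure set Y -> \bar R}) :
  measurable_fun [set: Y] S -> ergodic_invariant S nu ->
  (forall A, measurable A -> kappa (S @^-1` A) = kappa A) ->
  (forall A, measurable A -> kappa A <= nu A) ->
  forall A, measurable A -> kappa A = kappa [set: Y] * nu A.
Proof.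
move=> mS [inu enu] ikappa knu.
have kfin A : measurable A -> kappa A \is a fin_num.
  move=> mA; rewrite ge0_fin_numE//; apply: (le_lt_trans (knu _ mA)).
  by rewrite ltey_eq fin_num_measure.
pose kappa_mixin := isCharge.Build _ _ _ (Measure.sort kappa)
  (measure0 kappa) kfin (@measure_semi_sigma_additive _ _ _ kappa).
pose kappa' : {charge set Y -> \bar R} :=
  HB.pack (Measure.sort kappa) kappa_mixin.
pose c := fine (kappa [set: Y]).
have cE : c%:E = kappa [set: Y] by rewrite fineK// kfin.
pose sigma : {charge set Y -> \bar R} :=
  cadd kappa' (cscale (- c) (charge_of_finite_measure nu)).
have sigmaE A : sigma A = kappa A - c%:E * nu A.
  by rewrite -mulNe.
have [P [N PN]] := Hahn_decomposition sigma.
have [[mP posP] [mN negN] PNT PN0] := PN.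
have [|V [mV SV sV]] := invariant_hahn_set mS _ PN.
  by move=> A mA; rewrite !sigmaE ikappa// inu.
have sT : sigma setT = 0 by rewrite sigmaE probability_setT mule1 cE subee ?kfin.
have sV0 : sigma V = 0.
  have null B : measurable B -> nu B = 0 -> sigma B = 0.
    move=> mB B0; rewrite sigmaE B0 mule0 sube0; apply/eqP.
    by rewrite eq_le measure_ge0 andbT -B0 knu.
  have [V0|V1] := enu V mV SV; first exact: null.
  have mCV : measurable (~` V) by exact: measurableC.
  have nC : nu (~` V) = 0 by rewrite probability_setC// V1 subee.
  have := null _ mCV nC.
  by rewrite -setTD chargeD// setTI sT sub0e => /eqP; rewrite oppe_eq0 => /eqP.
have sP : sigma P = 0 by rewrite -sV.
have sN : sigma N = 0.
  have := charge_partition sigma measurableT mP mN PNT PN0.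
  by rewrite !setTI sT sP add0e.
move=> A mA.
have mAP := measurableI _ _ mA mP; have mAN := measurableI _ _ mA mN.
have sA : sigma A = 0.
  rewrite (charge_partition sigma mA mP mN PNT PN0).
  (* [A `&` P] has charge [0 - sigma (P `\` A)], which is nonpositive. *)
  have -> : sigma (A `&` P) = 0.
    apply/eqP; rewrite eq_le posP ?andbT//.
    have : 0 <= sigma (P `\` A) by apply: posP => //; exact: measurableD.
    by rewrite chargeD// sP sub0e oppe_ge0 setIC.
  rewrite add0e; apply/eqP; rewrite eq_le negN//=.
  have : sigma (N `\` A) <= 0 by apply: negN => //; exact: measurableD.
  by rewrite chargeD// sN sub0e oppe_le0 setIC.
have := sA; rewrite sigmaE cE => /eqP; rewrite sube_eq ?add0e.
- by move/eqP.
- by rewrite kfin.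
- by rewrite fin_num_adde_defr// kfin.
Qed.

End ergodic_extremality.

(** * Product measures and fibered maps *)

Section fibered.
Local Open Scope ereal_scope.
Context d1 d2 d3 d4 (Z : measurableType d1) (W : measurableType d2)
  (F : measurableType d3) (H : measurableType d4) (R : realType).

(** Fubini in the only form used below: a map that acts on the base, and in each
fibre by a map depending on the base point, sends a product measure to a product
measure as soon as it does so on the base and on every fibre separately. *)
Lemma fibered_product_measure (kappa : probability Z R) (mu : probability W R)
    (la : probability F R) (eta : probability H R) (t : Z -> W) (m : Z -> F -> H) :
  measurable_fun [set: Z] t ->
  measurable_fun [set: Z * F] (fun zg : Z * F => m zg.1 zg.2) ->
  (forall A, measurable A -> kappa (t @^-1` A) = mu A) ->
  (forall z A, measurable A -> la (m z @^-1` A) = eta A) ->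
  forall A, measurable A ->
    (kappa \x la) [set zg | A (t zg.1, m zg.1 zg.2)] = (mu \x eta) A.
Proof.
move=> mt mm tk ml A mA; rewrite /product_measure1.
transitivity (\int[kappa]_z ((eta \o xsection A) \o t) z).
  apply: eq_integral => z _ /=; rewrite -(ml z); last exact: measurable_xsection.
  by congr (la _); apply/seteqP; split => g /=; rewrite /xsection/= !inE.
transitivity (\int[pushforward kappa t]_w (eta \o xsection A) w).
  rewrite ge0_integral_pushforward//; exact: measurable_fun_xsection.
by apply: eq_measure_integral => B mB _; exact: tk.
Qed.

End fibered.

(** A mixture of laws all equal to [eta] is [eta]. *)
Lemma fiber_invariant_law d1 d2 d3 (Z : measurableType d1)
    (F : measurableType d2) (H : measurableType d3) (R : realType)
    (kappa : probability Z R) (la : probability F R) (eta : probability H R)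
    (m : Z -> F -> H) :
  measurable_fun [set: Z * F] (fun zg : Z * F => m zg.1 zg.2) ->
  (forall z A, measurable A -> la (m z @^-1` A) = eta A) ->
  forall A, measurable A ->
    (kappa \x la)%E [set zg | A (m zg.1 zg.2)] = eta A.
Proof.
move=> mm ml A mA.
have mTA : measurable ([set: Z] `*` A) by exact: measurableX.
have mid : measurable_fun [set: Z] id by exact: measurable_id.
transitivity ((kappa \x eta)%E ([set: Z] `*` A)); last first.
  by rewrite product_measure1E// [X in (X * _)%E](probability_setT kappa) mul1e.
rewrite -(fibered_product_measure mid mm (fun _ _ => erefl) ml mTA).
by congr ((_ \x _)%E _); apply/seteqP; split => p //= [].
Qed.

(** Image measures are produced through existence statements so that they can
be handled as opaque measures characterized by their values. *)
Lemma exists_image_probability d d' (Z : measurableType d)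
    (W : measurableType d') (R : realType) (P : probability Z R) (f : Z -> W) :
  measurable_fun [set: Z] f ->
  exists Q : probability W R, forall A, Q A = P (f @^-1` A).
Proof.
move=> mf; pose f_mixin := isMeasurableFun.Build _ _ _ _ _ mf.
pose f' : {mfun Z >-> W} := HB.pack f f_mixin.
by exists (distribution P f').
Qed.

Lemma exists_image_restr d d' (Z : measurableType d)
    (W : measurableType d') (R : realType) (P : {measure set Z -> \bar R})
    (D : set Z) (f : Z -> W) :
  measurable D -> measurable_fun [set: Z] f ->
  exists Q : {measure set W -> \bar R}, forall A, Q A = P (f @^-1` A `&` D).
Proof.
move=> mD mf; unshelve eexists (pushforward (mrestr P mD) f).
  exact: mf.
by [].
Qed.

Lemma product_measure_swap d1 d2 (Z : measurableType d1) (W : measurableType d2)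
    (R : realType) (P : probability Z R) (Q : probability W R) A :
  measurable A -> (P \x Q)%E A = (Q \x P)%E [set wz | A (wz.2, wz.1)].
Proof.
move=> mA.
have [M ME] := exists_image_probability (Q \x P)%E (@measurable_swap _ _ W Z).
transitivity (M A); last by rewrite ME.
apply: product_measure_unique => // B C mB mC.
transitivity ((Q \x P)%E [set wz | (B `*` C) (wz.2, wz.1)]); first exact: ME.
transitivity ((Q \x P)%E (C `*` B)); last by rewrite product_measure1E// muleC.
by congr ((_ \x _)%E _); apply/seteqP; split=> [[w z] /= []|[w z] /= []].
Qed.

(** * Haar measure *)

Lemma continuous_measurable_borel (X Y : ptopologicalType) (f : X -> Y) :
  continuous f -> measurable_fun [set: borel X] (f : borel X -> borel Y).
Proof.
move=> cf; apply: (@measurability _ _ _ (borel Y) _ _ (@open Y)) => //.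
move=> _ [U oU <-]; rewrite setTI; apply: sub_sigma_algebra.
by apply: open_comp => // x _; exact: cf.
Qed.

Section haar.
Local Open Scope ereal_scope.
Context (R : realType) (G : ptopologicalGroupType).
Hypothesis sG : @second_countable G.

Lemma measurable_mulg d (Z : measurableType d) (f g : Z -> borel G) :
  measurable_fun [set: Z] f -> measurable_fun [set: Z] g ->
  measurable_fun [set: Z] (fun z => ((f z : G) * (g z : G))%g : borel G).
Proof.
move=> mf mg; have mp := continuous_measurable_borel (@mulg_continuous G).
have mM := measurableT_comp mp (borel_prod_measurable sG sG).
exact: (measurableT_comp mM (measurable_fun_pair mf mg)).
Qed.

Lemma measurable_invg d (Z : measurableType d) (f : Z -> borel G) :
  measurable_fun [set: Z] f ->
  measurable_fun [set: Z] (fun z => (f z : G)^-1%g : borel G).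
Proof.
apply: measurableT_comp.
exact: (continuous_measurable_borel (@invg_continuous G)).
Qed.

Variable la : probability (borel G) R.
Hypothesis hla : haar_measure la.

(** Let [la'] be the image of [la] under inversion; it is right invariant.  The
law of [g h], for independent [g] of law [la'] and [h] of law [la], is [la] by
left invariance of [la], and is [la'] by right invariance of [la']. *)
Lemma haar_invg A : measurable A ->
  la ((fun g : borel G => (g : G)^-1%g : borel G) @^-1` A) = la A.
Proof.
have mV := measurable_invg (@measurable_id _ (borel G) setT).
have [la' la'E] := exists_image_probability la mV.
move=> mA; rewrite -la'E.
have mfst := @measurable_fst _ _ (borel G) (borel G).
have msnd := @measurable_snd _ _ (borel G) (borel G).
have mM := measurable_mulg mfst msnd; have mM' := measurable_mulg msnd mfst.
have rla' (g : borel G) B : measurable B ->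
    la' ((fun h : borel G => ((h : G) * (g : G))%g : borel G) @^-1` B) = la' B.
  move=> mB; rewrite !la'E.
  have mVB : measurable ((fun g : borel G => (g : G)^-1%g : borel G) @^-1` B).
    by rewrite -[X in measurable X]setTI; exact: mV.
  rewrite -(hla g^-1%g mVB); congr (la _); apply/seteqP.
  by split => h /=; rewrite invgM invgK.
rewrite -(fiber_invariant_law la mM' rla' mA).
rewrite -(fiber_invariant_law la' mM (fun g => hla g) mA).
rewrite product_measure_swap// -[X in measurable X]setTI; exact: mM'.
Qed.

Lemma haar_right_invariant (h : G) A : measurable A ->
  la ((fun g : borel G => ((g : G) * h)%g : borel G) @^-1` A) = la A.
Proof.
move=> mA.
have mV := measurable_invg (@measurable_id _ (borel G) setT).
have mR := measurable_mulg (@measurable_id _ (borel G) setT)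
  (measurable_cst (h : borel G)).
rewrite -haar_invg; last by rewrite -[X in measurable X]setTI; exact: mR.
rewrite -[RHS]haar_invg// -[RHS](hla h^-1%g); last first.
  by rewrite -[X in measurable X]setTI; exact: mV.
by congr (la _); apply/seteqP; split => g /=; rewrite invgM invgK.
Qed.

End haar.

(** * Uniqueness of the invariant lift *)

Section skew_product_measure.
Local Open Scope ereal_scope.
Context (R : realType) d (X : measurableType d) (G : ptopologicalGroupType).
Hypothesis sG : @second_countable G.
Variable la : probability (borel G) R.
Hypothesis hla : haar_measure la.
Variables (T : X -> X) (phi : X -> borel G).
Hypotheses (mT : measurable_fun [set: X] T) (mphi : measurable_fun [set: X] phi).
Variable mu : probability X R.

Local Notation Y := (X * borel G)%type.

Let S (y : Y) : Y := (T y.1, ((phi y.1 : G) * (y.2 : G))%g).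

Let translate (h : borel G) (y : Y) : Y := (y.1, ((y.2 : G) * (h : G))%g).

Lemma measurable_skew_product : measurable_fun [set: Y] S.
Proof.
apply: measurable_fun_pair; first exact: measurableT_comp.
by apply: measurable_mulg => //; exact: measurableT_comp.
Qed.

Let measurable_translate d' (Z : measurableType d') (f : Z -> borel G)
    (g : Z -> Y) :
  measurable_fun [set: Z] f -> measurable_fun [set: Z] g ->
  measurable_fun [set: Z] (fun z => translate (f z) (g z)).
Proof.
move=> mf mg; apply: measurable_fun_pair; first exact: measurableT_comp.
by apply: measurable_mulg => //; exact: measurableT_comp.
Qed.

Lemma invariant_skew_product : Defs.invariant T mu -> Defs.invariant S (mu \x la).
Proof.
move=> imu A mA.
rewrite /= -[RHS](fibered_product_measure mT _ imu (fun x => hla (phi x)))//.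
by apply: measurable_mulg => //; exact: measurableT_comp.
Qed.

Let invariant_translate h A : measurable A ->
  (mu \x la) (translate h @^-1` A) = (mu \x la) A.
Proof.
move=> mA; have mid : measurable_fun [set: X] id by exact: measurable_id.
rewrite -[RHS](fibered_product_measure mid _ (fun _ _ => erefl)
  (fun _ B mB => haar_right_invariant sG hla h mB))//.
by apply: measurable_mulg => //; exact: measurableT_comp.
Qed.

(** The lift [nu] is compared with [nu0 = mu \x la] through the joint law [M] of
[h] and of [nu] translated by [h], for [h] of law [la].  This law is
[la \x nu0], by extremality of [nu0]; since [M] determines [nu] by translating
back, and [nu0] is invariant under translations, [nu] and [nu0] agree. *)
Lemma skew_product_unique (nu : probability Y R) :
  Defs.invariant T mu -> ergodic S (mu \x la) ->
  Defs.invariant S nu ->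
  (forall A, measurable A -> nu (fst @^-1` A) = mu A) ->
  forall A, measurable A -> nu A = (mu \x la) A.
Proof.
move=> imu emu inu numu.
pose nu0 : probability Y R := mu \x la.
have mS := measurable_skew_product.
have mfst : measurable_fun [set: borel G * Y] fst by exact: measurable_fst.
have msnd : measurable_fun [set: borel G * Y] snd by exact: measurable_snd.
have pre d1 d2 (Z : measurableType d1) (W : measurableType d2) (f : Z -> W) A :
    measurable_fun [set: Z] f -> measurable A -> measurable (f @^-1` A).
  by move=> mf mA; rewrite -[X in measurable X]setTI; exact: mf.
have mtr : measurable_fun [set: borel G * Y]
  (fun p : borel G * Y => translate p.1 p.2) by exact: measurable_translate.
(* Averaging [nu] over right translations gives the product measure. *)
have average A : measurable A ->
    (la \x nu) [set p | A (translate p.1 p.2)] = nu0 A.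
  move=> mA; rewrite product_measure_swap/=; last exact: (pre _ _ _ _ _ _ mtr).
  have mfst' : measurable_fun [set: Y] fst by exact: measurable_fst.
  rewrite -(fibered_product_measure mfst' _ numu (fun y => hla y.2))//.
  by apply: measurable_mulg => //; exact: measurableT_comp.
(* The translation [h] and the translated point are independent: restricting
   to [h] in [B] gives an invariant measure dominated by the ergodic [nu0]. *)
have slice B A : measurable B -> measurable A ->
    (la \x nu) ((fun p => translate p.1 p.2) @^-1` A `&` (fst @^-1` B))
    = la B * nu0 A.
  move=> mB mA.
  have mB1 : measurable ((fst : borel G * Y -> _) @^-1` B) by exact: pre.
  have [k kE] := exists_image_restr (la \x nu) mB1 mtr.
  rewrite -kE (@ergodic_dominated _ _ _ S nu0 k)//.
  - congr (_ * _); rewrite kE preimage_setT setTI.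
    transitivity ((la \x nu) (B `*` [set: Y])).
      by congr ((_ \x _) _); apply/seteqP; split => [p|p []].
    by rewrite product_measure1E// [X in (_ * X)%E](probability_setT nu) mule1.
  - by split => //; exact: invariant_skew_product.
  - move=> C mC; rewrite !kE.
    have mid : measurable_fun [set: borel G] id by exact: measurable_id.
    have mS' : measurable_fun [set: borel G * Y] (fun p => S p.2).
      exact: measurableT_comp.
    have mC' : measurable ((fun p => translate p.1 p.2) @^-1` C `&` (fst @^-1` B)).
      by apply: measurableI => //; exact: pre.
    (* the right-hand side is unchanged when [S] is applied to the point before
       translating, and [S] commutes with translations *)
    rewrite -[RHS](fibered_product_measure mid mS' (fun _ _ => erefl)
      (fun _ D mD => inu D mD))//.
    by congr ((_ \x _) _); apply/seteqP; split => -[h [x g]] /=;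
      rewrite /S/translate/= mulgA.
  - move=> C mC; rewrite kE.
    have /eqP := average C mC; rewrite eq_le => /andP[+ _]; apply: le_trans.
    apply: le_measure; rewrite ?inE//.
    + by apply: measurableI => //; exact: pre.
    + exact: pre.
have [M ME] := exists_image_probability (la \x nu)
  (measurable_fun_pair mfst mtr).
have prodE C : measurable C -> (la \x nu0) C = M C.
  move=> mC; apply: (@product_measure_unique _ _ _ _ _ la nu0 M _ C mC).
  move=> B A mB mA; rewrite -slice//.
  transitivity (M (B `*` A)) => //; rewrite ME; congr ((_ \x _) _).
  by apply/seteqP; split => p /= [].
move=> A mA.
(* Both descriptions of the joint law are now translated back by [h^-1]. *)
have mtr' : measurable_fun [set: borel G * Y]
    (fun p : borel G * Y => translate ((p.1 : G)^-1)%g p.2).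
  by apply: measurable_translate => //; exact: measurable_invg.
have nu0E : (la \x nu0) [set p | A (translate ((p.1 : G)^-1)%g p.2)] = nu0 A.
  apply: (@fiber_invariant_law _ _ _ _ _ _ _ la nu0 nu0
    (fun h y => translate ((h : G)^-1)%g y)) => //.
  by move=> h C mC; exact: invariant_translate.
transitivity (nu0 A) => //.
rewrite -nu0E prodE ?ME; last exact: (pre _ _ _ _ _ _ mtr').
transitivity ((la \x nu) ([set: borel G] `*` A)).
  by rewrite product_measure1E// [X in (X * _)%E](probability_setT la) mul1e.
congr ((_ \x _) _); apply/seteqP; split => -[h [x g]] /=;
  rewrite /translate/= mulgK//.
by case.
Qed.

End skew_product_measure.

(** * Topology of the skew product *)

Lemma metric_metrizable (R : realType) (X : pmetricType R) : metrizable R X.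
Proof.
exists (@mdist R X); split.
- by move=> x y; split=> [/mdist_positivity//|->]; rewrite mdistxx.
- exact: metric_sym.
- by move=> x y z; exact: metric_triangle.
- move=> x; rewrite -filter_from_ballE; congr filter_from.
  by apply/funext => e; rewrite ballEmdist.
Qed.

Lemma metrizable_prod (R : realType) (X Y : topologicalType) :
  metrizable R X -> metrizable R Y -> metrizable R (X * Y)%type.
Proof.
move=> [d [d0 dC dD dn]] [d' [d'0 d'C d'D d'n]].
have dge0 x y : 0 <= d x y.
  have := dD x y x; rewrite (iffRL (d0 x x) erefl) (dC y x) -mulr2n.
  by rewrite pmulrn_lge0.
have d'ge0 x y : 0 <= d' x y.
  have := d'D x y x; rewrite (iffRL (d'0 x x) erefl) (d'C y x) -mulr2n.
  by rewrite pmulrn_lge0.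
exists (fun p q => d p.1 q.1 + d' p.2 q.2); split.
- move=> [x y] [x' y'] /=; split=> [/eqP|[-> ->]].
    by rewrite paddr_eq0// => /andP[/eqP/d0 -> /eqP/d'0 ->].
  by rewrite (iffRL (d0 _ _) erefl) (iffRL (d'0 _ _) erefl) addr0.
- by move=> p q; rewrite dC d'C.
- by move=> p q r; rewrite addrACA lerD.
- move=> [x y]; apply/seteqP; split=> U.
    move=> [[/= V W] []]; rewrite dn d'n => -[e /= e0 eV] [e' /= e'0 e'W] VWU.
    exists (Num.min e e') => /=; first by rewrite lt_min e0.
    move=> [a b] /=; rewrite lt_min => /andP[le le'].
    apply: VWU; split => /=; [apply: eV|apply: e'W] => /=.
      by apply: le_lt_trans le; rewrite lerDl.
    by apply: le_lt_trans le'; rewrite lerDr.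
  move=> [e /= e0 eU].
  exists ([set a | d x a < e / 2], [set b | d' y b < e / 2]) => /=.
    rewrite dn d'n; split; by exists (e / 2) => //=; rewrite divr_gt0.
  by move=> [a b] /= [xa yb]; apply: eU => /=; rewrite (splitr e) ltrD.
Qed.

Lemma continuous_pair (A X Y : topologicalType) (f : A -> X) (g : A -> Y) :
  continuous f -> continuous g -> continuous (fun a => (f a, g a)).
Proof. by move=> cf cg a; apply: cvg_pair; [exact: cf|exact: cg]. Qed.

Lemma continuous_skew_product (X : topologicalType) (G : ptopologicalGroupType)
    (T : X -> X) (phi : X -> G) :
  continuous T -> continuous phi -> continuous (skew_product T phi).
Proof.
move=> cT cphi; apply: continuous_pair => y.
  by apply: continuous_comp; [exact: cvg_fst|exact: cT].
apply: (@continuous_comp _ _ _ (fun y => (phi y.1, y.2))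
  (fun p : G * G => (p.1 * p.2)%g)); last exact: mulg_continuous.
apply: continuous_pair => {}y; last exact: cvg_snd.
by apply: continuous_comp; [exact: cvg_fst|exact: cphi].
Qed.

Lemma homeomorphism_skew_product (X : topologicalType) (G : ptopologicalGroupType)
    (T : X -> X) (phi : X -> G) :
  homeomorphism T -> continuous phi -> homeomorphism (skew_product T phi).
Proof.
move=> [cT [U cU [TU UT]]] cphi; split; first exact: continuous_skew_product.
(* the inverse is itself a skew product, over the inverse of the base map *)
exists (skew_product U (fun x => (phi (U x))^-1%g)).
  apply: continuous_skew_product => // x.
  apply: continuous_comp; last exact: invg_continuous.
  by apply: continuous_comp; [exact: cU|exact: cphi].
by split=> -[x g]; rewrite /skew_product /= ?TU ?UT ?mulKg ?mulVKg.
Qed.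

(** Together with [borel_prod_measurable] this identifies the Borel
sigma-algebra of a product of second countable spaces with the product of the
Borel sigma-algebras. *)
Lemma measurable_to_prod_borel (X Y : ptopologicalType) :
  measurable_fun [set: borel (X * Y)]
    (fun z : borel (X * Y) => z : borel X * borel Y).
Proof.
apply/measurable_fun_pairP; split.
  by apply: (@continuous_measurable_borel (X * Y)%type X fst) => z; exact: cvg_fst.
by apply: (@continuous_measurable_borel (X * Y)%type Y snd) => z; exact: cvg_snd.
Qed.

(** * The extension theorem *)

Theorem theorem15 (R : realType) (X : pmetricType R) (cX : compact [set: X])
    (T : X -> X) (hT : homeomorphism T)
    (mu : probability (borel X) R)
    (hmu : ergodic_invariant (T : borel X -> borel X) mu)
    (G : ptopologicalGroupType) (cG : compact [set: G]) (mG : metrizable R G)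
    (la : probability (borel G) R) (hla : haar_measure la)
    (phi : X -> G) (hphi : continuous phi) :
  let S : X * G -> X * G := skew_product T phi in
  let nu : probability (borel (X * G)) R :=
    borel_prod (compact_second_countable cX)
      (compact_metrizable_second_countable mG cG) mu la in
  ergodic (S : borel (X * G) -> borel (X * G)) nu ->
  uniquely_extends S T (fst : X * G -> X) nu mu.
Proof.
move=> S nu eS.
have sG := compact_metrizable_second_countable mG cG.
have sX := compact_second_countable cX.
have mT := continuous_measurable_borel hT.1.
have mphi := continuous_measurable_borel hphi.
have to_borel A : measurable (A : set (borel X * borel G)) ->
    measurable (A : set (borel (X * G))).
  by move=> mA; have := measurable_to_prod_borel measurableT mA; rewrite setTI.
have of_borel A : measurable (A : set (borel (X * G))) ->
    measurable (A : set (borel X * borel G)).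
  by move=> mA; have := borel_prod_measurable sX sG measurableT mA; rewrite setTI.
have nuE A : nu A = (mu \x la)%E (A : set (borel X * borel G)) by [].
have emula : ergodic (S : borel X * borel G -> borel X * borel G) (mu \x la)%E.
  by move=> A mA SA; exact: eS (to_borel A mA) SA.
split => //.
- split=> //.
  + split; [|exact: metrizable_prod (metric_metrizable X) mG|
             exact: homeomorphism_skew_product].
    by rewrite -setXTT; exact: compact_setX.
  + by split => //; exact: metric_metrizable.
  + by move=> y; exact: cvg_fst.
  + by move=> x _; exists (x, point).
- split; first split => //.
    move=> A mA; rewrite !nuE.
    exact: (invariant_skew_product sG hla mT mphi hmu.1 (of_borel A mA)).
  move=> A mA; rewrite /pushforward.
  transitivity ((mu \x la)%E (A `*` [set: borel G])).
    rewrite nuE; congr (product_measure1 mu la).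
    by apply/seteqP; split=> [p|p []].
  by rewrite product_measure1E// [X in (_ * X)%E](probability_setT la) mule1.
- move=> nu' [[inu' _] nu'mu] A mA.
  have [k kE] := exists_image_probability nu' (@measurable_to_prod_borel X G).
  transitivity (k A); first by rewrite kE.
  apply: (skew_product_unique sG hla mT mphi hmu.1 emula _ _ (of_borel A mA)).
    by move=> B mB; rewrite !kE; exact: inu' (to_borel B mB).
  by move=> B mB; rewrite kE; exact: nu'mu.
Qed.
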